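(* There exists a universal constant $C>0$ with the following property. Let $n\ge 2$ be an integer, let $\alpha>0$, and let $f:\{-1,1\}^n\to\{-1,1\}$ satisfy $I_{i,j}(f)\le \alpha n^{-2}\ln^2 n$ for all $1\le i<j\le n$. Then $\hat f^{2}(\emptyset)\ge 1-C\alpha$, or there exists exactly one $i\in[n]$ such that $\hat f^{2}(\{i\})\ge 1-C\alpha n^{-1}\ln n$.
   Context: Notation: $[n]=\{1,\dots,n\}$. The discrete cube $\{-1,1\}^n$ carries the uniform probability measure $\mu_n$, with expectation $\mathbb{E}$. For $A\subseteq[n]$, the Walsh function is $w_A(x)=\prod_{i\in A}x_i$ (with $w_\emptyset\equiv 1$), and for $f:\{-1,1\}^n\to\mathbb{R}$ the Walsh-Fourier coefficients are $\hat f(A)=\mathbb{E}[f\cdot w_A]=2^{-n}\sum_{x\in\{-1,1\}^n}f(x)w_A(x)$; $\hat f^2(A)$ means $(\hat f(A))^2$. For distinct $i,j\in[n]$, the influence of the couple $(i,j)$ on $f$ is $I_{i,j}(f)=\sum_{A\subseteq[n]:\, i,j\in A}\hat f^2(A)$. Also, $\ln^2 n=(\ln n)^2$. *)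

(* Defs.v *)
From mathcomp Require Import all_boot all_order all_algebra.
From mathcomp Require Import reals exp.
Set Implicit Arguments.
Unset Strict Implicit.
Unset Printing Implicit Defensive.
Import Order.TTheory GRing.Theory Num.Theory.
Local Open Scope ring_scope.

(* Points of {-1,1}^n are encoded by their sign bits: [x i = true] means that
   the i-th coordinate is -1, see [coord]. Indices run over {0, ..., n-1}. *)
Definition cube (n : nat) := {ffun 'I_n -> bool}.

Section WalshFourier.
Variables (R : realType) (n : nat).
Implicit Types (f : cube n -> R) (A : {set 'I_n}).

Definition coord (x : cube n) (i : 'I_n) : R := (-1) ^+ x i.

Definition expectation f : R := 2 ^- n * \sum_(x : cube n) f x.

Definition walsh A (x : cube n) : R := \prod_(i in A) coord x i.

Definition fourier f A : R := expectation (fun x => f x * walsh A x).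

Definition influence2 f (i j : 'I_n) : R :=
  \sum_(A : {set 'I_n} | (i \in A) && (j \in A)) fourier f A ^+ 2.

End WalshFourier.

(* Main.v *)
(* The engine is an inequality of Kahn-Kalai-Linial type: if g takes values in
   {-1, 0, 1}, all influences of g are at most delta and n delta^2 <= 1, then
   Var g <= K n delta / ln n. High degrees are controlled by the total
   influence, low degrees by hypercontractivity applied to each laplacian.

   It is used twice. Applied to the discrete derivative D_i f, whose influences
   are the I_{i,j}(f), it gives p_i - fhat({i})^2 <= eps with p_i = I_i(f) and
   eps = K alpha ln n / n. As |fhat({i})| <= p_i, this forces p_i (1 - p_i) <= eps,
   so either p_i >= 1/2 and fhat({i})^2 >= 1 - 3 eps, or p_i <= 2 eps. If the
   latter holds for every i, the same inequality applied to f itself gives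
   1 - fhat(emptyset)^2 = Var f <= 2 K^2 alpha. *)
Require Import Defs.
From mathcomp Require Import all_boot all_order all_algebra.
From mathcomp Require Import reals exp.
From mathcomp Require Import ring lra.
Set Implicit Arguments.
Unset Strict Implicit.
Unset Printing Implicit Defensive.
Import Order.TTheory GRing.Theory Num.Theory.
Local Open Scope ring_scope.

Section Cube.
Variables (R : realType) (n : nat).
Implicit Types (f g h : cube n -> R) (i j : 'I_n) (A B : {set 'I_n}).
Implicit Types (a b : {set 'I_n} -> R).
Local Notation "''E' f" := (@expectation R n f) (at level 10, f at level 8).

(** * Expectation on the cube and Cauchy-Schwarz *)

Lemma eq_expectation f g : f =1 g -> 'E f = 'E g.
Proof. by move=> e; congr (_ * _); apply: eq_bigr => x _; rewrite e. Qed.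

Lemma expectationD f g : 'E (fun x => f x + g x) = 'E f + 'E g.
Proof. by rewrite /expectation big_split mulrDr. Qed.

Lemma expectationZ (c : R) f : 'E (fun x => c * f x) = c * 'E f.
Proof. by rewrite /expectation -mulr_sumr mulrCA. Qed.

Lemma expectation_sum (I : finType) (P : pred I) (F : I -> cube n -> R) :
  'E (fun x => \sum_(i | P i) F i x) = \sum_(i | P i) 'E (F i).
Proof. by rewrite /expectation exchange_big mulr_sumr. Qed.

Lemma expectation_cst (c : R) : 'E (fun=> c) = c.
Proof.
rewrite /expectation sumr_const card_ffun card_bool card_ord -(mulr_natl c).
by rewrite natrX mulKf // expf_neq0 // pnatr_eq0.
Qed.

Lemma expectation_ge0 f : (forall x, 0 <= f x) -> 0 <= 'E f.
Proof. by move=> h; rewrite mulr_ge0 ?sumr_ge0 // invr_ge0 exprn_ge0. Qed.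

Lemma ler_expectation f g : (forall x, f x <= g x) -> 'E f <= 'E g.
Proof. by move=> h; rewrite ler_wpM2l ?ler_sum // invr_ge0 exprn_ge0. Qed.

Lemma expectation_Cauchy f g :
  ('E (fun x => f x * g x)) ^+ 2 <= 'E (fun x => f x ^+ 2) * 'E (fun x => g x ^+ 2).
Proof.
set u := 'E (fun x => _ * _); set v := 'E _; set w := 'E _.
have key (s t : R) : 0 <= s ^+ 2 * v + 2 * (s * t) * u + t ^+ 2 * w.
  rewrite -!expectationZ -!expectationD; apply: expectation_ge0 => x.
  suff -> : s ^+ 2 * f x ^+ 2 + 2 * (s * t) * (f x * g x) + t ^+ 2 * g x ^+ 2 =
    (s * f x + t * g x) ^+ 2 by exact: sqr_ge0.
  by ring.
have w0 : 0 <= w by apply: expectation_ge0 => x; exact: sqr_ge0.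
have v0 : 0 <= v by apply: expectation_ge0 => x; exact: sqr_ge0.
(* If [w = 0], the choice [s = - u], [t = v + 1] leaves [- u ^+ 2 * (v + 2) >= 0], so [u = 0].
   Otherwise [s = w], [t = - u] gives [w * (v * w - u ^+ 2) >= 0]. *)
move: w0; rewrite le0r => /predU1P[w0|w0].
  have := key (- u) (v + 1); rewrite w0; nra.
by have := key w (- u); nra.
Qed.

(** * Walsh functions: orthonormality, inversion and Parseval *)

Definition flip (j : 'I_n) (x : cube n) : cube n := [ffun i => x i (+) (i == j)].

Lemma flipK j : involutive (flip j).
Proof. by move=> x; apply/ffunP => i; rewrite !ffunE -addbA addbb addbF. Qed.

Lemma expectation_flip j f : 'E (fun x => f (flip j x)) = 'E f.
Proof.
congr (_ * _); rewrite [RHS](reindex_inj (h := flip j)) //.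
exact: inv_inj (flipK j).
Qed.

Lemma walsh_flip A j x : walsh R A (flip j x) = (-1) ^+ (j \in A) * walsh R A x.
Proof.
have cf i : Defs.coord R (flip j x) i = (-1) ^+ (i == j) * Defs.coord R x i.
  by rewrite /Defs.coord ffunE signr_addb mulrC.
rewrite /walsh; under eq_bigr do rewrite cf.
rewrite big_split /=; congr (_ * _).
have [jA|jA] := boolP (j \in A).
  rewrite (bigD1 j) //= eqxx big1 ?mulr1 // => i /andP[_ /negbTE ->].
  by rewrite expr0.
rewrite big1 // => i iA; case: eqVneq => // e.
by rewrite -e iA in jA.
Qed.

Lemma walsh_sqr A x : walsh R A x * walsh R A x = 1.
Proof.
rewrite /walsh -big_split big1 //= => i _.
by rewrite /Defs.coord -expr2 sqrr_sign.
Qed.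

Lemma walsh0 (x : cube n) : walsh R set0 x = 1 :> R.
Proof. by rewrite /walsh big_set0. Qed.

Lemma expectation_walshM A B :
  'E (fun x => walsh R A x * walsh R B x) = (A == B)%:R.
Proof.
case: eqVneq => [->|].
  by under eq_expectation do rewrite walsh_sqr; rewrite expectation_cst.
rewrite eqEsubset negb_and => nAB.
have [j jAB] : exists j, (j \in A) != (j \in B).
  case/orP: nAB => /subsetPn[j ja jb]; exists j;
  by rewrite ja (negbTE jb).
(* Flipping a coordinate that lies in exactly one of [A] and [B] preserves the measure and negates
   the product. *)
set e := 'E _; suff : e = - e by move=> ee; rewrite mulr0n; lra.
rewrite /e -[LHS](expectation_flip j) -mulN1r -expectationZ.
apply: eq_expectation => x; rewrite !walsh_flip.
by move: jAB; case: (j \in A); case: (j \in B) => // _; rewrite ?expr0 ?expr1; ring.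
Qed.

(** Inverse Walsh transform: truncated or restricted spectra are handled as coefficient families on
    the same cube. *)
Definition walsh_sum a (x : cube n) : R := \sum_A a A * walsh R A x.

Lemma expectation_walsh_sumM a b :
  'E (fun x => walsh_sum a x * walsh_sum b x) = \sum_A a A * b A.
Proof.
rewrite /walsh_sum; under eq_expectation do rewrite big_distrlr /=.
rewrite expectation_sum; apply: eq_bigr => A _.
rewrite expectation_sum (bigD1 A) //= [X in _ + X]big1 => [|B BA].
  under eq_expectation do rewrite mulrACA walsh_sqr mulr1.
  by rewrite expectation_cst addr0.
under eq_expectation do rewrite mulrACA.
by rewrite expectationZ expectation_walshM eq_sym (negbTE BA) mulr0.
Qed.

(** The sum is the expansion of the product of the factors [1 + x_i y_i]; a coordinate where [x] and
    [y] differ kills its factor. Fourier inversion follows from it. *)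
Lemma walsh_kernel (x y : cube n) :
  \sum_A walsh R A x * walsh R A y = 2 ^+ n * (x == y)%:R.
Proof.
transitivity (\prod_i (Defs.coord R x i * Defs.coord R y i + 1)).
  rewrite (bigA_distr _ _ _ (fun=> 1)); apply: eq_bigr => A _.
  by rewrite -big_split /= big_mkcond.
case: eqVneq => [->|nxy].
  rewrite mulr1 -[in RHS](card_ord n) -prodr_const; apply: eq_bigr => i _.
  by rewrite /Defs.coord -expr2 sqrr_sign.
have [i xy] : exists i, x i != y i.
  apply/existsP; apply: contra_neqT nxy; rewrite negb_exists => /forallP e.
  by apply/ffunP => i; have /negPn/eqP := e i.
rewrite (bigD1 i) //= /Defs.coord -signr_addb -negb_eqb xy expr1.
by rewrite addNr mul0r mulr0.
Qed.

Lemma walsh_sum_fourier f x : walsh_sum (fourier f) x = f x.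
Proof.
rewrite /walsh_sum /fourier.
under eq_bigr do rewrite mulrC -expectationZ.
rewrite -expectation_sum.
under eq_expectation => y.
  under eq_bigr do rewrite mulrCA.
  rewrite -mulr_sumr walsh_kernel; over.
rewrite /expectation (bigD1 x) //= big1 ?addr0 => [|y /negbTE nyx].
  by rewrite eqxx mulr1 mulrC mulfK // expf_neq0 // pnatr_eq0.
by rewrite eq_sym nyx !mulr0.
Qed.

Lemma fourier_walsh_sum a A : fourier (walsh_sum a) A = a A.
Proof.
rewrite /fourier /walsh_sum.
under eq_expectation do rewrite mulr_suml.
rewrite expectation_sum (bigD1 A) //= big1 => [|B BA].
  under eq_expectation do rewrite -mulrA walsh_sqr mulr1.
  by rewrite expectation_cst addr0.
under eq_expectation do rewrite -mulrA.
by rewrite expectationZ expectation_walshM (negbTE BA) mulr0.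
Qed.

Lemma Parseval f : 'E (fun x => f x ^+ 2) = \sum_A fourier f A ^+ 2.
Proof.
rewrite -expectation_walsh_sumM; apply: eq_expectation => x.
by rewrite walsh_sum_fourier.
Qed.

(** * Splitting along one coordinate and hypercontractivity *)

Lemma sum_set_split (j : 'I_n) (F : {set 'I_n} -> R) :
  \sum_A F A = \sum_(A : {set 'I_n} | j \notin A) F A +
    \sum_(A : {set 'I_n} | j \notin A) F (j |: A).
Proof.
rewrite (bigID (fun A : {set 'I_n} => j \notin A)) /=; congr (_ + _).
rewrite (reindex_onto (fun A : {set _} => j |: A) (fun A : {set _} => A :\ j)) /= => [|A].
  apply: eq_bigl => A; rewrite negbK setU11 /=.
  apply/eqP/idP => [<-|/setU1K //]; by rewrite !inE eqxx.
by rewrite negbK => /setD1K.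
Qed.

Lemma walshU1 (j : 'I_n) A x : j \notin A ->
  walsh R (j |: A) x = Defs.coord R x j * walsh R A x.
Proof. by move=> jA; rewrite /walsh big_setU1. Qed.

Lemma expectation_coordM0 j h : (forall x, h (flip j x) = h x) ->
  'E (fun x => Defs.coord R x j * h x) = 0.
Proof.
move=> hj; set e := 'E _; suff : e = - e by move=> ?; lra.
rewrite /e -[LHS](expectation_flip j) -mulN1r -expectationZ.
apply: eq_expectation => x; rewrite hj /Defs.coord ffunE eqxx signr_addb expr1; ring.
Qed.

(* Hypercontractivity from L^2 to L^4 for the noise parameter 1/sqrt 3. *)
Lemma Bonami a :
  'E (fun x => walsh_sum a x ^+ 4) <= (\sum_(A : {set 'I_n}) 3 ^+ #|A| * a A ^+ 2) ^+ 2.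
Proof.
(* The induction runs on the size of a set [V] of coordinates carrying the spectrum, so the cube
   itself never changes. *)
suff aux m (V : {set 'I_n}) : #|V| = m -> forall a,
    (forall A, ~~ (A \subset V) -> a A = 0) ->
    'E (fun x => walsh_sum a x ^+ 4) <= (\sum_(A : {set 'I_n}) 3 ^+ #|A| * a A ^+ 2) ^+ 2.
  by apply: (aux _ [set: 'I_n] erefl) => A; rewrite subsetT.
elim: m V => [|m IH] V Vm {}a aV.
  have a0 A : A != set0 -> a A = 0.
    by move=> A0; apply: aV; rewrite (cards0_eq Vm) subset0.
  rewrite (bigD1 set0) //= big1 => [|A A0]; last by rewrite a0 // expr0n mulr0.
  have e x : walsh_sum a x = a set0.
    rewrite /walsh_sum (bigD1 set0) //= walsh0 big1 ?addr0 ?mulr1 // => A A0.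
    by rewrite a0 // mul0r.
  under eq_expectation do rewrite e.
  by rewrite expectation_cst cards0 expr0 mul1r addr0 -exprM.
have [j jV] : exists j, j \in V by apply/set0Pn; rewrite -card_gt0 Vm.
(* Decomposition [p + x_j q]: both parts have spectrum inside [V :\ j] and do not depend on
   coordinate [j]. *)
pose p A := if j \in A then 0 else a A.
pose q A := if j \in A then 0 else a (j |: A).
have supp c : (forall A, j \in A -> c A = 0) ->
    (forall A, j \notin A -> c A = a A \/ c A = a (j |: A)) ->
    forall A, ~~ (A \subset V :\ j) -> c A = 0.
  move=> c1 c2 A; rewrite subsetD1 negb_and negbK.
  have [jA _|jA] := boolP (j \in A); first exact: c1.
  rewrite orbF => AV; case: (c2 A jA) => ->; apply: aV => //.
  by apply: contra AV; apply: subset_trans; exact: subsetUr.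
have Vjm : #|V :\ j| = m by move: Vm; rewrite (cardsD1 j) jV => -[].
have IHp : 'E (fun x => walsh_sum p x ^+ 4) <=
    (\sum_(A : {set 'I_n}) 3 ^+ #|A| * p A ^+ 2) ^+ 2.
  apply: (IH _ Vjm); apply: supp => A; rewrite /p; first by move=> ->.
  by move=> /negbTE ->; left.
have IHq : 'E (fun x => walsh_sum q x ^+ 4) <=
    (\sum_(A : {set 'I_n}) 3 ^+ #|A| * q A ^+ 2) ^+ 2.
  apply: (IH _ Vjm); apply: supp => A; rewrite /q; first by move=> ->.
  by move=> /negbTE ->; right.
have half c (F : {set 'I_n} -> R -> R) : (forall A, F A 0 = 0) ->
    \sum_A F A (if j \in A then 0 else c A) = \sum_(A : {set 'I_n} | j \notin A) F A (c A).
  move=> F0; rewrite (sum_set_split j) [X in _ + X]big1 ?addr0 => [|A _].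
    by apply: eq_bigr => A /negbTE ->.
  by rewrite setU11 F0.
have -> : \sum_(A : {set 'I_n}) 3 ^+ #|A| * a A ^+ 2 =
    \sum_(A : {set 'I_n}) 3 ^+ #|A| * p A ^+ 2 +
    3 * \sum_(A : {set 'I_n}) 3 ^+ #|A| * q A ^+ 2.
  rewrite /p /q (half _ (fun A t => 3 ^+ #|A| * t ^+ 2)); last first.
    by move=> A; rewrite expr0n mulr0.
  rewrite (half _ (fun A t => 3 ^+ #|A| * t ^+ 2)); last first.
    by move=> A; rewrite expr0n mulr0.
  rewrite (sum_set_split j) mulr_sumr; congr (_ + _).
  by apply: eq_bigr => A jA; rewrite cardsU1 jA add1n exprS mulrA.
have apq x : walsh_sum a x = walsh_sum p x + Defs.coord R x j * walsh_sum q x.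
  rewrite /walsh_sum (sum_set_split j) /p /q.
  rewrite (half _ (fun A t => t * walsh R A x)); last by move=> A; rewrite mul0r.
  rewrite (half _ (fun A t => t * walsh R A x)); last by move=> A; rewrite mul0r.
  rewrite mulr_sumr; congr (_ + _); apply: eq_bigr => A jA.
  by rewrite walshU1 // mulrCA.
have inv c : (forall A, j \in A -> c A = 0) ->
    forall x, walsh_sum c (flip j x) = walsh_sum c x.
  move=> c0 x; rewrite /walsh_sum; apply: eq_bigr => A _; rewrite walsh_flip.
  by have [/c0->|_] := boolP (j \in A); rewrite ?mul0r // expr0 mul1r.
have pinv : forall x, walsh_sum p (flip j x) = walsh_sum p x.
  by apply: inv => A; rewrite /p => ->.
have qinv : forall x, walsh_sum q (flip j x) = walsh_sum q x.
  by apply: inv => A; rewrite /q => ->.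
move: IHp IHq.
set P := \sum_A _ * p A ^+ 2; set Q := \sum_A _ * q A ^+ 2 => IHp IHq.
have P0 : 0 <= P by apply: sumr_ge0 => A _; rewrite mulr_ge0 ?sqr_ge0 ?exprn_ge0.
have Q0 : 0 <= Q by apply: sumr_ge0 => A _; rewrite mulr_ge0 ?sqr_ge0 ?exprn_ge0.
(* In the binomial expansion the terms odd in [x_j] have mean zero, and even powers of [x_j] equal
   1. *)
have -> : 'E (fun x => walsh_sum a x ^+ 4) = 'E (fun x => walsh_sum p x ^+ 4) +
    6 * 'E (fun x => walsh_sum p x ^+ 2 * walsh_sum q x ^+ 2) +
    'E (fun x => walsh_sum q x ^+ 4).
  rewrite -[RHS]addr0 -(@expectation_coordM0 j (fun x => 4 *
    (walsh_sum p x ^+ 3 * walsh_sum q x + walsh_sum p x * walsh_sum q x ^+ 3))).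
    rewrite -expectationZ -!expectationD; apply: eq_expectation => x.
    rewrite apq; have : Defs.coord R x j ^+ 2 = 1 by rewrite sqrr_sign.
    move: (Defs.coord R x j) (walsh_sum p x) (walsh_sum q x) => c u v c2.
    have c3 : c ^+ 3 = c by rewrite exprSr c2 mul1r.
    have c4 : c ^+ 4 = 1 by rewrite exprSr c3 -expr2.
    have -> : (u + c * v) ^+ 4 = u ^+ 4 + 4 * u ^+ 3 * c * v +
      6 * u ^+ 2 * c ^+ 2 * v ^+ 2 + 4 * u * c ^+ 3 * v ^+ 3 + c ^+ 4 * v ^+ 4.
      by ring.
    by rewrite c2 c3 c4; ring.
  by move=> x; rewrite pinv qinv.
have := expectation_Cauchy (fun x => walsh_sum p x ^+ 2) (fun x => walsh_sum q x ^+ 2).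
under [X in _ <= X * _ -> _]eq_expectation do rewrite -exprM.
under [X in _ <= _ * X -> _]eq_expectation do rewrite -exprM.
set T := 'E _ => CS.
have TPQ : T <= P * Q.
  have T0 : 0 <= T by apply: expectation_ge0 => x; rewrite mulr_ge0 ?sqr_ge0.
  have PQ0 : 0 <= P * Q by rewrite mulr_ge0.
  rewrite -ler_sqr ?nnegrE //.
  apply: le_trans CS _; rewrite exprMn ler_pM //;
  by apply: expectation_ge0 => x; rewrite exprM sqr_ge0.
(* The weight 3 on [Q] makes the cross term of [(P + 3 * Q) ^+ 2] exactly [6 * (P * Q)]. *)
apply: (@le_trans _ _ (P ^+ 2 + 6 * (P * Q) + Q ^+ 2)); first by lra.
by nra.
Qed.

(** * Influences, laplacians and low-degree bounds *)

(** Covers both sign-valued functions and their discrete derivatives, so that one variance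
    inequality serves for both. *)
Definition ternary g := forall x, [\/ g x = -1, g x = 0 | g x = 1].

Definition influence1 f j : R := \sum_(A : {set 'I_n} | j \in A) fourier f A ^+ 2.

Definition laplacian f j (x : cube n) : R := (f x - f (flip j x)) / 2.

(** The factor [x_j] removes the dependence on coordinate [j] and moves the coefficient of each [A]
    containing [j] to [A :\ j]. *)
Definition derivative f j (x : cube n) : R := Defs.coord R x j * laplacian f j x.

Lemma laplacianE f j x :
  laplacian f j x = walsh_sum (fun A => if j \in A then fourier f A else 0) x.
Proof.
rewrite /laplacian -(walsh_sum_fourier f x) -(walsh_sum_fourier f (flip j x)).
rewrite /walsh_sum -sumrB mulr_suml; apply: eq_bigr => A _.
by rewrite walsh_flip; case: (j \in A); rewrite ?expr0 ?expr1; field.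
Qed.

Lemma influence1E f j : influence1 f j = 'E (fun x => laplacian f j x ^+ 2).
Proof.
rewrite /influence1 big_mkcond.
under [RHS]eq_expectation do rewrite laplacianE expr2.
rewrite expectation_walsh_sumM; apply: eq_bigr => A _.
by case: ifP => _; rewrite ?mulr0.
Qed.

Lemma influence1_ge0 f j : 0 <= influence1 f j.
Proof. by apply: sumr_ge0 => A _; exact: sqr_ge0. Qed.

(* The laplacian takes values in {0, 1/2, -1/2, 1, -1}, so its support has
   measure at most [4 * influence1 g j]; pairing it with its own low-degree part
   and using Bonami's lemma gains a factor [sqrt (influence1 g j)]. *)
Lemma low_degree_influence k g j : ternary g ->
  (\sum_(A : {set 'I_n} | (j \in A) && (#|A| <= k)%N) fourier g A ^+ 2) ^+ 2 <=
    4 * 9 ^+ k * influence1 g j ^+ 3.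
Proof.
move=> g3; set a := \sum_(A : {set 'I_n} | _) _.
pose c A := if (j \in A) && (#|A| <= k)%N then fourier g A else 0.
(* [u] is the part of the laplacian [l] of degree at most [k], and [s] is the indicator of the
   support of [l]; inserting [s] does not change the pairing of [u] with [l]. *)
pose u := walsh_sum c; pose l := laplacian g j.
pose s x : R := (l x != 0)%:R.
have a0 : 0 <= a by apply: sumr_ge0 => A _; exact: sqr_ge0.
have ul : 'E (fun x => u x * s x * l x) = a.
  transitivity ('E (fun x => u x * l x)).
    apply: eq_expectation => x; rewrite /s.
    by case: eqVneq => [->|_]; rewrite ?mulr0 ?mulr1.
  under eq_expectation do rewrite /l laplacianE.
  rewrite expectation_walsh_sumM /a [RHS]big_mkcond; apply: eq_bigr => A _.
  by rewrite /c; case: (j \in A); case: (#|A| <= k)%N; rewrite /= ?mul0r ?mulr0.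
have u4 : 'E (fun x => u x ^+ 4) <= 9 ^+ k * a ^+ 2.
  apply: le_trans (Bonami c) _.
  have -> : 9 ^+ k * a ^+ 2 = (3 ^+ k * a) ^+ 2.
    by rewrite exprMn -exprM mulnC exprM -[3 ^+ 2]natrX.
  have m0 : 0 <= \sum_(A : {set 'I_n}) 3 ^+ #|A| * c A ^+ 2 :> R.
    by apply: sumr_ge0 => A _; rewrite mulr_ge0 ?sqr_ge0 ?exprn_ge0.
  rewrite ler_pXn2r ?nnegrE ?mulr_ge0 ?exprn_ge0 //.
  rewrite /a mulr_sumr [leRHS]big_mkcond; apply: ler_sum => A _; rewrite /c.
  case: ifP => [/andP[_ Ak]|_]; last by rewrite expr0n mulr0.
  by rewrite ler_wpM2r ?sqr_ge0 // ler_weXn2l // ler1n.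
(* A nonzero value of [l] has modulus at least 1/2, whence the factor 4. *)
have s4 : 'E (fun x => s x ^+ 2) <= 4 * influence1 g j.
  rewrite influence1E -expectationZ; apply: ler_expectation => x.
  rewrite /s -/(l x); case: eqVneq => [->|]; first by rewrite !expr0n mulr0.
  rewrite /l /laplacian expr1n.
  by case: (g3 x) => ->; case: (g3 (flip j x)) => -> l0; try lra;
    rewrite ?subrr ?mul0r ?eqxx in l0.
(* With [T] the mean of [u ^+ 2 * s ^+ 2], these give [a ^+ 2 <= T * I], then bound [T ^+ 2] by the
   fourth moment of [u] times the measure of the support. Hence
   [a ^+ 4 <= 9 ^+ k * a ^+ 2 * 4 * I ^+ 3], and [a ^+ 2] cancels. *)
have CS1 := expectation_Cauchy (fun x => u x * s x) l.
have CS2 := expectation_Cauchy (fun x => u x ^+ 2) (fun x => s x ^+ 2).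
rewrite ul -influence1E in CS1.
have e1 : 'E (fun x => (u x * s x) ^+ 2) = 'E (fun x => u x ^+ 2 * s x ^+ 2).
  by apply: eq_expectation => x; rewrite exprMn.
have e2 : 'E (fun x => (u x ^+ 2) ^+ 2) = 'E (fun x => u x ^+ 4).
  by apply: eq_expectation => x; rewrite -exprM.
have e3 : 'E (fun x => (s x ^+ 2) ^+ 2) = 'E (fun x => s x ^+ 2).
  by apply: eq_expectation => x; rewrite /s; case: eqP; rewrite ?expr1n ?expr0n.
rewrite e1 in CS1; rewrite e2 e3 in CS2.
set T := 'E (fun x => u x ^+ 2 * s x ^+ 2) in CS1 CS2.
set I := influence1 g j in CS1 s4 *.
have I0 : 0 <= I := influence1_ge0 g j.
have T0 : 0 <= T by apply: expectation_ge0 => x; rewrite mulr_ge0 ?sqr_ge0.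
have s0 : 0 <= 'E (fun x => s x ^+ 2) by apply: expectation_ge0 => x; exact: sqr_ge0.
have u0 : 0 <= 'E (fun x => u x ^+ 4).
  by apply: expectation_ge0 => x; rewrite (exprM _ 2 2) sqr_ge0.
have T2 : T ^+ 2 <= 9 ^+ k * a ^+ 2 * (4 * I).
  by apply: le_trans CS2 _; exact: ler_pM.
have a4 : a ^+ 2 * a ^+ 2 <= a ^+ 2 * (4 * 9 ^+ k * I ^+ 3).
  apply: (@le_trans _ _ (T ^+ 2 * I ^+ 2)).
    have TI0 : 0 <= T * I by exact: mulr_ge0.
    by rewrite -expr2 -exprMn ler_pXn2r ?nnegrE ?sqr_ge0.
  have -> : a ^+ 2 * (4 * 9 ^+ k * I ^+ 3) = 9 ^+ k * a ^+ 2 * (4 * I) * I ^+ 2 by ring.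
  by rewrite ler_wpM2r ?sqr_ge0.
move: a0; rewrite le0r => /predU1P[->|a0].
  by rewrite expr0n mulr_ge0 ?mulr_ge0 ?exprn_ge0.
by move: a4; rewrite ler_pM2l // exprn_gt0.
Qed.

(** * Combining low and high degrees into the variance inequality *)

Lemma sum_card_influence1 g :
  \sum_(A : {set 'I_n}) #|A|%:R * fourier g A ^+ 2 = \sum_j influence1 g j.
Proof.
rewrite /influence1 (exchange_big_dep predT) //=; apply: eq_bigr => A _.
by rewrite sumr_const mulr_natl.
Qed.

Lemma variance_low_high k g (delta : R) : ternary g -> 0 <= delta ->
    (forall j, influence1 g j <= delta) -> n%:R * delta ^+ 2 <= 1 ->
    (9 ^ (4 * k) <= n)%N ->
  (\sum_(A : {set 'I_n} | A != set0) fourier g A ^+ 2) * k.+1%:R <= 3 * n%:R * delta.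
Proof.
move=> g3 d0 Id nd kn.
pose a j := \sum_(A : {set 'I_n} | (j \in A) && (#|A| <= k)%N) fourier g A ^+ 2.
have k0 : 0 < k.+1%:R :> R by rewrite ltr0n.
have aj j : a j * k.+1%:R <= 2 * delta.
  have aI := low_degree_influence k j g3; rewrite -/(a j) in aI.
  have a0 : 0 <= a j by apply: sumr_ge0 => A _; exact: sqr_ge0.
  rewrite -(@ler_pXn2r _ 2) ?nnegrE ?mulr_ge0 //.
  have kt : k.+1%:R ^+ 2 <= 9 ^+ k :> R.
    have -> : 9 ^+ k = (3 ^+ k) ^+ 2 :> R.
      by rewrite -exprM mulnC exprM -[3 ^+ 2]natrX.
    rewrite ler_pXn2r ?nnegrE ?exprn_ge0 // -natrX ler_nat.
    exact: ltn_expl.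
  (* Squared, this is [9 ^ (4 * k) * delta ^+ 2 <= n * delta ^+ 2 <= 1]: the exponent [4 * k] in the
     hypothesis is chosen for this. *)
  have t1 : (9 ^+ k) ^+ 2 * delta <= 1 :> R.
    rewrite -(@ler_pXn2r _ 2) ?nnegrE ?mulr_ge0 ?exprn_ge0 // expr1n exprMn.
    apply: le_trans nd; rewrite ler_wpM2r ?sqr_ge0 // -!exprM -natrX ler_nat.
    by rewrite -mulnA mulnC.
  have t0 : 0 <= 9 ^+ k :> R by rewrite exprn_ge0.
  move: t0 t1 kt aI; move: (9 ^+ k) => t t0 t1 kt aI.
  have I3 : influence1 g j ^+ 3 <= delta ^+ 3.
    by rewrite ler_pXn2r ?nnegrE ?influence1_ge0.
  rewrite exprMn; apply: (@le_trans _ _ (4 * t * delta ^+ 3 * t)).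
    apply: ler_pM; rewrite ?sqr_ge0 //; apply: le_trans aI _.
    by rewrite ler_wpM2l // mulr_ge0.
  have -> : 4 * t * delta ^+ 3 * t = 4 * delta ^+ 2 * (t ^+ 2 * delta) by ring.
  have -> : (2 * delta) ^+ 2 = 4 * delta ^+ 2 * 1 by ring.
  by rewrite ler_wpM2l // mulr_ge0 ?sqr_ge0.
have sumI : \sum_j influence1 g j <= n%:R * delta.
  apply: le_trans (ler_sum _ (fun j _ => Id j)) _.
  by rewrite sumr_const card_ord -[leLHS]mulr_natl.
have suma : \sum_j a j * k.+1%:R <= n%:R * (2 * delta).
  apply: le_trans (ler_sum _ (fun j _ => aj j)) _.
  by rewrite sumr_const card_ord -[leLHS]mulr_natl.
(* A nonempty [A] of size at most [k] is counted [#|A| >= 1] times on the right. *)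
have low : \sum_(A : {set 'I_n} | (A != set0) && (#|A| <= k)%N) fourier g A ^+ 2 <= \sum_j a j.
  rewrite /a (exchange_big_dep (fun A => (#|A| <= k)%N)) /=; last by move=> j A _ /andP[].
  rewrite big_andbC big_mkcondr /=; apply: ler_sum => A Ak; rewrite Ak.
  under eq_bigl do rewrite andbT.
  rewrite sumr_const; case: (set_0Vmem A) => [->|[j jA]].
    by rewrite eqxx cards0 mulr0n.
  case: ifP => _; last by rewrite mulrn_wge0 ?sqr_ge0.
  rewrite -[leLHS]mulr1n ler_wpMn2l ?sqr_ge0 // card_gt0.
  by apply/set0Pn; exists j.
(* Beyond degree [k] one has [k.+1 <= #|A|], so the total influence dominates. *)
have high :
    (\sum_(A : {set 'I_n} | (A != set0) && ~~ (#|A| <= k)%N) fourier g A ^+ 2)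
      * k.+1%:R <= \sum_j influence1 g j.
  rewrite -sum_card_influence1 mulr_suml big_mkcond; apply: ler_sum => A _.
  case: ifP => [/andP[_ Ak]|_]; last by rewrite mulr_ge0 ?sqr_ge0.
  by rewrite mulrC ler_wpM2r ?sqr_ge0 // ler_nat ltnNge.
rewrite (bigID (fun A : {set 'I_n} => (#|A| <= k)%N)) /= mulrDl.
have -> : 3 * n%:R * delta = n%:R * (2 * delta) + n%:R * delta by ring.
apply: lerD; last exact: le_trans high sumI.
by apply: le_trans suma; rewrite -mulr_suml ler_wpM2r // ltW.
Qed.

Lemma variance_ln_le g (delta : R) : (0 < n)%N -> ternary g -> 0 <= delta ->
    (forall j, influence1 g j <= delta) -> n%:R * delta ^+ 2 <= 1 ->
  (\sum_(A : {set 'I_n} | A != set0) fourier g A ^+ 2) * ln n%:R <= 12 * ln 9 * n%:R * delta.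
Proof.
(* The largest [k] with [9 ^ (4 * k) <= n]; by maximality [ln n <= 4 * k.+1 * ln 9], and the
   constant is [3 * 4 * ln 9]. *)
move=> n0 g3 d0 Id nd; pose k := trunc_log (9 ^ 4) n.
have M1 : (1 < 9 ^ 4)%N by rewrite (@ltn_exp2l 9 0 4).
have kn : (9 ^ (4 * k) <= n)%N by rewrite expnM; exact: trunc_logP.
have V := variance_low_high g3 d0 Id nd kn.
have V0 : 0 <= \sum_(A : {set 'I_n} | A != set0) fourier g A ^+ 2.
  by apply: sumr_ge0 => A _; exact: sqr_ge0.
have nk : ln n%:R <= (k.+1%:R * (4 * ln 9)) :> R.
  have -> : k.+1%:R * (4 * ln 9) = ln (9 ^+ (4 * k.+1)) :> R.
    by rewrite lnXn // mulrnA !mulr_natl.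
  rewrite ler_ln ?posrE ?exprn_gt0 ?ltr0n // -natrX ler_nat expnM.
  exact/ltnW/trunc_log_ltn.
have l9 : 0 <= 4 * ln 9 :> R by rewrite mulr_ge0 // ln_ge0 // ler1n.
apply: le_trans (ler_wpM2l V0 nk) _; rewrite [leLHS]mulrA.
apply: le_trans (ler_wpM2r l9 V) _.
by rewrite le_eqVlt; apply/orP; left; apply/eqP; ring.
Qed.

(** * Spectrum and influences of the discrete derivative *)

Lemma derivativeE f i x : derivative f i x =
  walsh_sum (fun A => if i \in A then 0 else fourier f (i |: A)) x.
Proof.
rewrite /derivative laplacianE /walsh_sum !(sum_set_split i).
rewrite big1 ?add0r => [|A /negbTE ->]; last by rewrite mul0r.
rewrite [X in _ = _ + X]big1 ?addr0 => [|A _]; last by rewrite setU11 mul0r.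
rewrite mulr_sumr; apply: eq_bigr => A iA; rewrite setU11 (negbTE iA) walshU1 //.
by rewrite mulrCA (mulrA (Defs.coord R x i)) -expr2 sqrr_sign mul1r.
Qed.

Lemma fourier_derivative f i A :
  fourier (derivative f i) A = if i \in A then 0 else fourier f (i |: A).
Proof.
transitivity (fourier (walsh_sum (fun A => if i \in A then 0 else fourier f (i |: A))) A).
  by apply: eq_expectation => x; rewrite derivativeE.
by rewrite fourier_walsh_sum.
Qed.

Lemma ternary_derivative f i : (forall x, f x = -1 \/ f x = 1) ->
  ternary (derivative f i).
Proof.
move=> f2 x; rewrite /derivative /laplacian /Defs.coord.
case: (x i); rewrite ?expr0 ?expr1; case: (f2 x) => ->; case: (f2 (flip i x)) => ->;
by [apply: Or31; lra | apply: Or32; lra | apply: Or33; lra].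
Qed.

(** The spectral shift by [i] makes the couple hypothesis a bound on ordinary influences; the
    diagonal vanishes because the derivative does not depend on coordinate [i]. *)
Lemma influence1_derivative f i j : influence1 (derivative f i) j =
  if j == i then 0 else influence2 f i j.
Proof.
rewrite /influence1 /influence2; under eq_bigr do rewrite fourier_derivative.
case: eqVneq => [->|ji]; first by rewrite big1 // => A ->; rewrite expr0n.
rewrite [LHS]big_mkcond [RHS]big_mkcond !(sum_set_split i) /=.
rewrite [X in _ + X = _]big1 => [|A _]; last by rewrite setU11 expr0n if_same.
rewrite [X in _ = X + _]big1 ?addr0 ?add0r => [|A /negbTE -> //].
by apply: eq_bigr => A iA; rewrite (negbTE iA) setU11 in_setU1 (negbTE ji).
Qed.

Lemma sum_fourier_derivative f i :
  \sum_A fourier (derivative f i) A ^+ 2 = influence1 f i.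
Proof.
rewrite /influence1 [RHS]big_mkcond !(sum_set_split i).
rewrite [X in _ + X = _]big1 => [|A _]; last by rewrite fourier_derivative setU11 expr0n.
rewrite [X in _ = X + _]big1 ?addr0 ?add0r => [|A /negbTE -> //].
by apply: eq_bigr => A iA; rewrite fourier_derivative (negbTE iA) setU11.
Qed.

Lemma variance_derivative f i :
  \sum_(A : {set 'I_n} | A != set0) fourier (derivative f i) A ^+ 2 =
    influence1 f i - fourier f [set i] ^+ 2.
Proof.
rewrite -sum_fourier_derivative [in RHS](bigD1 set0) //=.
by rewrite fourier_derivative inE setU0 addrAC subrr add0r.
Qed.

(** The coefficient is the mean of the derivative and the influence its second moment; values in
    {-1, 0, 1} satisfy [|t| = t ^+ 2]. *)
Lemma fourier1_le_influence1 f i : (forall x, f x = -1 \/ f x = 1) ->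
  `|fourier f [set i]| <= influence1 f i.
Proof.
move=> /(ternary_derivative i) d3.
have -> : fourier f [set i] = 'E (derivative f i).
  transitivity (fourier (derivative f i) set0).
    by rewrite fourier_derivative inE setU0.
  by apply: eq_expectation => x; rewrite walsh0 mulr1.
rewrite -sum_fourier_derivative -Parseval ler_norml; apply/andP; split.
  rewrite lerNl -mulN1r -expectationZ; apply: ler_expectation => x.
  by case: (d3 x) => ->; lra.
by apply: ler_expectation => x; case: (d3 x) => ->; lra.
Qed.

Lemma influence2C f i j : influence2 f i j = influence2 f j i.
Proof. by apply: eq_bigl => A; rewrite andbC. Qed.

End Cube.

(** * Logarithm estimates *)

(** From [ln n = 2 ln (sqrt n) <= 2 sqrt n]; it serves to check [n * delta ^+ 2 <= 1] in both uses
    of the variance inequality. *)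
Lemma ln_sqr_le (R : realType) (n : nat) : (0 < n)%N -> ln n%:R ^+ 2 <= 4 * n%:R :> R.
Proof.
move=> n0; have np : 0 < n%:R :> R by rewrite ltr0n.
pose s : R := Num.sqrt n%:R.
have s0 : 0 < s by rewrite sqrtr_gt0.
have sn : s ^+ 2 = n%:R by rewrite sqr_sqrtr // ltW.
have ls : ln n%:R <= 2 * s.
  by rewrite -sn lnXn // -[leLHS]mulr_natl ler_pM2l // ltW // ln_sublinear.
have l0 : 0 <= ln n%:R :> R by rewrite ln_ge0 // ler1n.
have -> : 4 * n%:R = (2 * s) ^+ 2 by rewrite exprMn sn -natrX.
by rewrite ler_pXn2r ?nnegrE ?mulr_ge0 // ltW.
Qed.

Lemma ln_le_half (R : realType) (n : nat) : (0 < n)%N -> ln n%:R <= n%:R / 2 :> R.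
Proof.
move=> n0; have np : 0 < n%:R :> R by rewrite ltr0n.
have half x : 0 < x -> ln x <= x - 1 :> R.
  move=> x0; have := @le_ln1Dx R (x - 1).
  by rewrite [1 + _]addrC subrK; apply; lra.
have h1 : ln (n%:R / 2) <= n%:R / 2 - 1 :> R by apply: half; rewrite divr_gt0.
have h2 : ln 2 <= 1 :> R by have := half 2 (ltr0Sn _ _); lra.
have -> : ln n%:R = ln (n%:R / 2) + ln 2 :> R.
  by rewrite -lnM ?posrE ?divr_gt0 // divfK ?pnatr_eq0.
lra.
Qed.

(** * The dichotomy for one coordinate and the conclusion *)

Lemma sqr_fourier1_pair_le1 (R : realType) (n : nat) (f : cube n -> R) (i j : 'I_n) :
  (forall x, f x = -1 \/ f x = 1) -> i != j ->
  fourier f [set i] ^+ 2 + fourier f [set j] ^+ 2 <= 1.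
Proof.
move=> f2 ij; have E1 := Parseval f.
have f1 : expectation (fun x => f x ^+ 2) = 1.
  rewrite -[RHS](expectation_cst n); apply: eq_expectation => x.
  by case: (f2 x) => ->; rewrite ?sqrrN expr1n.
rewrite -f1 E1 (bigD1 [set i]) //= lerD2l (bigD1 [set j]) /=.
  by rewrite lerDl sumr_ge0 // => A _; exact: sqr_ge0.
by rewrite (inj_eq set1_inj) eq_sym.
Qed.

Lemma dictator_or_small_influence (R : realType) (n : nat) (alpha : R)
    (f : cube n -> R) (i : 'I_n) :
  let K := 12 * ln 9 : R in
  let eps := K * alpha * (ln n%:R / n%:R) in
  (2 <= n)%N -> 0 < alpha -> alpha <= 4^-1 ->
  (forall x : cube n, f x = -1 \/ f x = 1) ->
  (forall i j : 'I_n, (i < j)%N ->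
     influence2 f i j <= alpha * n%:R ^- 2 * ln n%:R ^+ 2) ->
  1 - 3 * eps <= fourier f [set i] ^+ 2 \/ influence1 f i <= 2 * eps.
Proof.
move=> K eps n2 a0 a4 f2 If.
have n0 : (0 < n)%N by exact: ltnW.
have np : 0 < n%:R :> R by rewrite ltr0n.
have L0 : 0 < ln n%:R :> R by rewrite ln_gt0 // ltr1n.
have L2 := @ln_sqr_le R n n0.
pose d := alpha * n%:R ^- 2 * ln n%:R ^+ 2.
have d0 : 0 <= d by rewrite !mulr_ge0 ?sqr_ge0 ?invr_ge0 ?sqr_ge0 ?ltW.
have Id j : influence1 (derivative f i) j <= d.
  rewrite influence1_derivative; case: eqVneq => // ji.
  case: (ltngtP i j) => [ij|ij|/val_inj ij]; first exact: If.
    by rewrite influence2C; exact: If.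
  by rewrite ij eqxx in ji.
have nd : n%:R * d ^+ 2 <= 1.
  have -> : n%:R * d ^+ 2 = (alpha * (ln n%:R ^+ 2 / n%:R)) ^+ 2 / n%:R.
    by rewrite /d; field; rewrite gt_eqF.
  rewrite ler_pdivrMr // mul1r; apply: (@le_trans _ _ 1); last by rewrite ler1n.
  have q0 : 0 <= ln n%:R ^+ 2 / n%:R :> R by rewrite mulr_ge0 ?sqr_ge0 // invr_ge0 ltW.
  have q4 : ln n%:R ^+ 2 / n%:R <= 4 :> R by rewrite ler_pdivrMr.
  have aq0 := mulr_ge0 (ltW a0) q0; rewrite expr_le1 //.
  rewrite -[leRHS](@mulVf R 4) ?pnatr_eq0 //.
  by apply: ler_pM => //; exact: ltW.
have := variance_ln_le n0 (ternary_derivative i f2) d0 Id nd.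
rewrite variance_derivative -/K.
have -> : K * n%:R * d = eps * ln n%:R.
  by rewrite /d /eps; field; rewrite gt_eqF.
rewrite ler_pM2r //.
have := fourier1_le_influence1 i f2.
rewrite -[fourier f [set i] ^+ 2]real_normK ?num_real //.
have := normr_ge0 (fourier f [set i]).
move: (`|_|) (influence1 _ _) => m p m0 mp pe.
have e0 : 0 <= eps by rewrite !mulr_ge0 ?invr_ge0 ?ln_ge0 ?ler1n ?ltW.
have m2 : m ^+ 2 <= p ^+ 2 by rewrite ler_pXn2r ?nnegrE // (le_trans m0).
(* Here [p - p ^+ 2 <= eps]. If [p < 1/2] then [p / 2 <= eps]. If [1/2 <= p <= 1] then
   [1 - p <= 2 * eps], so [m ^+ 2 >= p - eps >= 1 - 3 * eps]; for [p > 1] the last bound is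
   immediate. *)
have [p2|p2] := leP 2^-1 p; last by right; nra.
by left; have [p1|p1] := leP p 1; nra.
Qed.

Theorem theorem2p1 (R : realType) :
  exists C : R, 0 < C /\
    forall (n : nat) (alpha : R) (f : cube n -> R),
      (2 <= n)%N -> 0 < alpha ->
      (forall x : cube n, f x = -1 \/ f x = 1) ->
      (forall i j : 'I_n, (i < j)%N ->
         influence2 f i j <= alpha * n%:R ^- 2 * ln n%:R ^+ 2) ->
      1 - C * alpha <= fourier f set0 ^+ 2 \/
      (exists! i : 'I_n,
         1 - C * alpha * n%:R^-1 * ln n%:R <= fourier f [set i] ^+ 2).
Proof.
(* In [C], [2 * K ^+ 2] is the final variance constant, [4 * K] covers the [3 * eps] loss and yields
   [4 * K * alpha <= 1], and 4 yields [alpha <= 1/4]. *)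
pose K : R := 12 * ln 9; pose C := 2 * K ^+ 2 + 4 * K + 4.
have K0 : 0 < K by rewrite mulr_gt0 // ln_gt0 // ltr1n.
have K2 : 0 <= K ^+ 2 by exact: sqr_ge0.
exists C; split; first by rewrite /C; lra.
move=> n alpha f n2 a0 f2 If.
(* For [C * alpha >= 1] the first alternative is trivial; below, [alpha] is small. *)
have [Ca|Ca] := leP 1 (C * alpha).
  by left; apply: le_trans (sqr_ge0 _); rewrite subr_le0.
have a4 : alpha <= 4^-1 by rewrite /C in Ca; nra.
have Ka : 4 * K * alpha <= 1 by rewrite /C in Ca; nra.
have n0 : (0 < n)%N by exact: ltnW.
have np : 0 < n%:R :> R by rewrite ltr0n.
have L0 : 0 < ln n%:R :> R by rewrite ln_gt0 // ltr1n.
pose q : R := ln n%:R / n%:R.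
have q0 : 0 < q by rewrite divr_gt0.
have q2 : q <= 2^-1 by rewrite ler_pdivrMr // mulrC ln_le_half.
have Lq : n%:R * q = ln n%:R by rewrite mulrC divfK // gt_eqF.
have eC : C * alpha * n%:R^-1 * ln n%:R = C * alpha * q.
  by rewrite -mulrA [_^-1 * _]mulrC.
rewrite eC.
have dich i := dictator_or_small_influence i n2 a0 a4 f2 If.
have [/existsP[i iD]|/existsPn noD] :=
    boolP [exists i : 'I_n, 1 - C * alpha * q <= fourier f [set i] ^+ 2].
  right; exists i; split => // j jD; apply/eqP; apply: contraT => ij.
  (* Since [C * alpha < 1] and [q <= 1/2], each squared coefficient would exceed 1/2. *)
  by have := sqr_fourier1_pair_le1 f2 ij; nra.
left; pose eps := K * alpha * q.
have Ke : 3 * eps <= C * alpha * q.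
  have aq : 0 <= alpha * q by rewrite mulr_ge0 // ltW.
  by rewrite /eps /C; nra.
have I1 i : influence1 f i <= 2 * eps.
  case: (dich i) => // D; have /negP[] := noD i.
  by apply: le_trans D; rewrite lerD2l lerN2.
have e0 : 0 <= 2 * eps by have := mulr_gt0 (mulr_gt0 K0 a0) q0; rewrite -/eps; lra.
(* The left side is at most [(4 * K * alpha) ^+ 2]. *)
have ne : n%:R * (2 * eps) ^+ 2 <= 1.
  have -> : n%:R * (2 * eps) ^+ 2 = (2 * K * alpha) ^+ 2 * (ln n%:R ^+ 2 / n%:R).
    by rewrite /eps /q; field; rewrite gt_eqF.
  have L2 : ln n%:R ^+ 2 / n%:R <= 4 :> R by rewrite ler_pdivrMr // ln_sqr_le.
  have Ka0 : 0 < K * alpha by rewrite mulr_gt0.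
  have Q0 : 0 <= (2 * K * alpha) ^+ 2 by exact: sqr_ge0.
  by apply: le_trans (ler_wpM2l Q0 L2) _; nra.
have f3 : ternary f by move=> x; case: (f2 x) => ->; [apply: Or31|apply: Or33].
have := variance_ln_le n0 f3 e0 I1 ne; rewrite -/K.
have -> : K * n%:R * (2 * eps) = 2 * K ^+ 2 * alpha * ln n%:R.
  by rewrite -Lq /eps; ring.
rewrite ler_pM2r //.
have : \sum_A fourier f A ^+ 2 = 1.
  rewrite -Parseval -[RHS](expectation_cst n); apply: eq_expectation => x.
  by case: (f2 x) => ->; rewrite ?sqrrN expr1n.
rewrite (bigD1 set0) //= => e1 V; rewrite /C; nra.
Qed.
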